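(* Let $n\ge 2$. Given a configuration of $n+2$ oriented spheres $S_1,S_2,\ldots,S_{n+2}$ in $\mathbb{R}^n$ (allowing hyperplanes), let $\mathbf{M}$ be the $(n+2)\times(n+1)$ matrix whose $j$-th row is the curvature-center coordinate vector $\mathbf{m}(S_j)$ of the $j$-th sphere. If this configuration is an oriented Descartes configuration, then $$\mathbf{M}^T\mathbf{Q}_n\mathbf{M} = \begin{bmatrix} 0&0\\0&2I_n\end{bmatrix} = \mathrm{diag}(0,2,2,\ldots,2).$$ Conversely, any real solution $\mathbf{M}$ (an $(n+2)\times(n+1)$ matrix) to this equation is the matrix of a unique oriented Descartes configuration.
   Context: $\mathbf{Q}_n := I_{n+2} - \frac1n \mathbf{1}_{n+2}\mathbf{1}_{n+2}^T$, where $\mathbf{1}_{n+2}$ is the column vector of $n+2$ ones. An oriented sphere in $\mathbb{R}^n$ is an $(n-1)$-sphere with an assigned direction of unit normal vector, inward or outward. If it has radius $\rho>0$, its oriented radius is $r=\rho$ for an inward normal and $r=-\rho$ for an outward normal, and its oriented (signed) curvature is $b=1/r$. Its interior is the usual interior for an inward normal and the usual exterior for an outward normal. Hyperplanes are allowed as oriented spheres of curvature $0$: an oriented hyperplane has a specified unit normal vector $\mathbf{h}$, and its interior is the open half-space into which $\mathbf{h}$ points. Two parallel hyperplanes are regarded as tangent at infinity. An oriented Descartes configuration in $\mathbb{R}^n$ consists of $n+2$ mutually tangent oriented spheres (hyperplanes allowed), all pairs having distinct points of tangency, such that either the interiors of all of them are disjoint, or they are disjoint after all orientations are reversed. Curvature-center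 coordinates: for an oriented sphere $S$ with oriented curvature $b\ne0$ and center $(x_1,\ldots,x_n)$, $\mathbf{m}(S)=(b,bx_1,\ldots,bx_n)$; for an oriented hyperplane $H$ with unit normal $\mathbf{h}=(h_1,\ldots,h_n)$ giving its orientation, $\mathbf{m}(H)=(0,h_1,\ldots,h_n)$.
   Formalization: The converse is proved for solutions M whose first (curvature) column is nonzero; it fails otherwise, e.g. n=2 with rows (0,1,0),(0,-1,0),(0,0,1),(0,0,-1), since a Descartes configuration contains at most two hyperplanes. *)

(* Defs.v *)
From HB Require Import structures.
From mathcomp Require Import all_boot all_order all_algebra.
From mathcomp Require Import boolp classical_sets reals.

Set Implicit Arguments.
Unset Strict Implicit.
Unset Printing Implicit Defensive.

Import Order.TTheory GRing.Theory Num.Theory.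

Local Open Scope classical_set_scope.
Local Open Scope ring_scope.

Section EuclideanSpace.
Variables (R : realType) (n : nat).

Definition dot (u v : 'rV[R]_n) : R := \sum_i u 0 i * v 0 i.

Definition enorm (u : 'rV[R]_n) : R := Num.sqrt (dot u u).

Lemma enormN (u : 'rV[R]_n) : enorm (- u) = enorm u.
Proof.
by congr Num.sqrt; apply: eq_bigr => i _; rewrite !mxE mulrNN.
Qed.

End EuclideanSpace.

Section OrientedSpheres.
Variables (R : realType) (n : nat).

(* The side conditions are boolean, hence proof-irrelevant: two oriented
   spheres are Leibniz-equal iff they are the same geometric object with the
   same orientation.  [OHyperplane h c _] is {p | <h, p> = c} with unit normal
   h; the pair (h, c) is determined by the oriented hyperplane. *)
Inductive osphere : Type :=
| OSphere (center : 'rV[R]_n) (radius : R) of 0 < radius & bool (* inward? *)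
| OHyperplane (normal : 'rV[R]_n) (offset : R) of enorm normal == 1.

(* Points of the sphere in the one-point compactification of R^n: [Some p] is
   the point p and [None] is the point at infinity, which lies on every
   hyperplane and on no sphere. *)
Definition points (S : osphere) : set (option 'rV[R]_n) :=
  match S with
  | OSphere x rho _ _ => [set q | if q is Some p then enorm (p - x) = rho
                                  else False]
  | OHyperplane h c _ => [set q | if q is Some p then dot h p = c else True]
  end.

Definition interior (S : osphere) : set 'rV[R]_n :=
  match S with
  | OSphere x rho _ inward =>
      if inward then [set p | enorm (p - x) < rho]
      else [set p | rho < enorm (p - x)]
  | OHyperplane h c _ => [set p | c < dot h p]
  end.

Lemma unit_opp (h : 'rV[R]_n) : enorm h == 1 -> enorm (- h) == 1.
Proof. by rewrite enormN. Qed.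

Definition reverse (S : osphere) : osphere :=
  match S with
  | OSphere x rho rho_gt0 inward => OSphere x rho_gt0 (~~ inward)
  | OHyperplane h c h_unit => OHyperplane (- c) (unit_opp h_unit)
  end.

(* Tangency means having exactly one common point, possibly at infinity (the
   case of two distinct parallel hyperplanes).  This is the right notion only
   for n >= 2: a 0-sphere is a pair of points. *)
Definition tangent_at (S T : osphere) (q : option 'rV[R]_n) : Prop :=
  points S `&` points T = [set q].

Definition oriented_Descartes (S : {ffun 'I_n.+2 -> osphere}) : Prop :=
  [/\ forall i j, i != j -> exists q, tangent_at (S i) (S j) q,
      forall i j k l q, i != j -> k != l ->
        tangent_at (S i) (S j) q -> tangent_at (S k) (S l) q ->
        (i = k /\ j = l) \/ (i = l /\ j = k)
    & trivIset [set: 'I_n.+2] (fun i => interior (S i)) \/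
      trivIset [set: 'I_n.+2] (fun i => interior (reverse (S i)))].

Definition oriented_radius (rho : R) (inward : bool) : R :=
  if inward then rho else - rho.

Definition curvature_center (S : osphere) : 'rV[R]_(1 + n) :=
  match S with
  | OSphere x rho _ inward =>
      let b := (oriented_radius rho inward)^-1 in row_mx b%:M (b *: x)
  | OHyperplane h _ _ => row_mx 0 h
  end.

Definition curvature_center_mx (S : {ffun 'I_n.+2 -> osphere}) :
    'M[R]_(n.+2, 1 + n) :=
  \matrix_(j < n.+2) curvature_center (S j).

Definition Qform : 'M[R]_n.+2 :=
  1%:M - n%:R^-1 *: (const_mx 1 *m (const_mx 1 : 'cV[R]_n.+2)^T).

End OrientedSpheres.

Arguments Qform : clear implicits.

(* Main.v *)
(* An oriented sphere corresponds to a vector w of norm 1 in R^(n+1,1): the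
   points of the sphere are the null directions orthogonal to w, its interior
   consists of the future null directions having positive product with w, and
   reversing the orientation negates w.  A Descartes configuration is then a
   family of n+2 vectors with Gram matrix 2 I - J, where J is all ones.  Indeed
   w_i + w_j is null and spans the direction of the tangency point, and the
   sums w_i + w_j all lie in the same half of the cone, which makes the
   orientations globally consistent.  As Q = 2 (2 I - J)^-1, the condition on
   the Gram matrix of W = [a | b | X] is equivalent to W^T Q W = 2 G^-1, with G
   the matrix of the Lorentz form; the equation for M = [b | X] is a block of
   this one, and the missing column a can be recovered from M when b != 0. *)

Require Import Defs.
From HB Require Import structures.
From mathcomp Require Import all_boot all_order all_algebra.
From mathcomp Require Import boolp classical_sets reals.
From mathcomp Require Import ring lra.

Import Order.TTheory GRing.Theory Num.Theory.

Local Open Scope ring_scope.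

(** * Euclidean inner product *)

Section Dot.
Context {R : realType} {n : nat}.
Implicit Types u v w : 'rV[R]_n.

Lemma dotC u v : dot u v = dot v u.
Proof. by apply: eq_bigr => i _; rewrite mulrC. Qed.

Lemma dotDl u v w : dot (u + v) w = dot u w + dot v w.
Proof. by rewrite -big_split; apply: eq_bigr => i _; rewrite mxE mulrDl. Qed.

Lemma dotZl t u v : dot (t *: u) v = t * dot u v.
Proof. by rewrite /dot mulr_sumr; apply: eq_bigr => i _; rewrite mxE mulrA. Qed.

Lemma dotNl u v : dot (- u) v = - dot u v.
Proof. by rewrite -scaleN1r dotZl mulN1r. Qed.

Lemma dot0l u : dot 0 u = 0.
Proof. by rewrite -(scale0r (0 : 'rV_n)) dotZl mul0r. Qed.

Lemma dotDr u v w : dot w (u + v) = dot w u + dot w v.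
Proof. by rewrite dotC dotDl !(dotC w). Qed.

Lemma dotZr t u v : dot v (t *: u) = t * dot v u.
Proof. by rewrite dotC dotZl dotC. Qed.

Lemma dotNr u v : dot v (- u) = - dot v u.
Proof. by rewrite dotC dotNl dotC. Qed.

Lemma dot0r u : dot u 0 = 0.
Proof. by rewrite dotC dot0l. Qed.

Definition dot_bilinear :=
  (dotDl, dotDr, dotNl, dotNr, dotZl, dotZr, dot0l, dot0r).

Lemma dot_ge0 u : 0 <= dot u u.
Proof. by apply: sumr_ge0 => i _; rewrite -expr2 sqr_ge0. Qed.

Lemma dot_eq0 u : dot u u = 0 -> u = 0.
Proof.
move=> /eqP; rewrite psumr_eq0 => [|i _]; last by rewrite -expr2 sqr_ge0.
move=> /allP u0; apply/rowP => i; rewrite mxE.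
by have := u0 i (mem_index_enum i); rewrite mulf_eq0 orbb => /eqP.
Qed.

Lemma sqr_enorm u : enorm u ^+ 2 = dot u u.
Proof. exact: sqr_sqrtr (dot_ge0 u). Qed.

Lemma enorm_ge0 u : 0 <= enorm u.
Proof. exact: sqrtr_ge0. Qed.

End Dot.

(** * Points and oriented spheres as vectors of Lorentz space *)

Section LorentzModel.
Context {R : realType} {n : nat}.
Implicit Types (u v w : R * R * 'rV[R]_n) (S T : osphere R n).
Implicit Types (p : 'rV[R]_n) (q : option 'rV[R]_n).

(** The polarization of [|X|^2 - a b], of signature [(n+1, 1)], with [a] and [b] as null
    coordinates. *)
Definition lorentz u v : R :=
  dot u.2 v.2 - (u.1.1 * v.1.2 + v.1.1 * u.1.2) / 2.

Lemma lorentzC u v : lorentz u v = lorentz v u.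
Proof. rewrite /lorentz dotC; ring. Qed.

Lemma lorentzDl u v w : lorentz (u + v) w = lorentz u w + lorentz v w.
Proof. rewrite /lorentz /= dotDl; ring. Qed.

Lemma lorentzDr u v w : lorentz w (u + v) = lorentz w u + lorentz w v.
Proof. by rewrite lorentzC lorentzDl !(lorentzC w). Qed.

Definition scale_vector (t : R) u : R * R * 'rV[R]_n :=
  (t * u.1.1, t * u.1.2, t *: u.2).

Lemma lorentzZl t u v : lorentz (scale_vector t u) v = t * lorentz u v.
Proof. rewrite /lorentz /= dotZl; ring. Qed.

Lemma lorentzZr t u v : lorentz v (scale_vector t u) = t * lorentz v u.
Proof. by rewrite lorentzC lorentzZl lorentzC. Qed.

Lemma lorentzNl u v : lorentz (- u) v = - lorentz u v.
Proof. rewrite /lorentz /= dotNl; ring. Qed.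

Lemma lorentzNr u v : lorentz v (- u) = - lorentz v u.
Proof. by rewrite lorentzC lorentzNl lorentzC. Qed.

(** The paraboloid lift of R^n into the null cone; infinity is the one null direction that the
    paraboloid misses. *)
Definition null_vector q : R * R * 'rV[R]_n :=
  if q is Some p then (dot p p, 1, p) else (1, 0, 0).

(** For finite points the product is [- |p - p'|^2 / 2]. *)
Lemma null_vector_le0 q q' :
  lorentz (null_vector q) (null_vector q') <= 0.
Proof.
rewrite /lorentz; case: q q' => [p|] [p'|] /=; rewrite ?dot_bilinear; try lra.
have := dot_ge0 (p - p'); rewrite !dot_bilinear (dotC p' p); lra.
Qed.

Lemma null_vector_param u :
  lorentz u u = 0 -> exists t q, u = scale_vector t (null_vector q).
Proof.
case: u => [[a b] X]; rewrite /lorentz /= => u0.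
have [b0|bN0] := eqVneq b 0.
  have X0 : X = 0 by apply: dot_eq0; move: u0; rewrite b0; lra.
  exists a, None; rewrite b0 X0; congr (_, _, _) => /=.
  - by rewrite mulr1.
  - by rewrite mulr0.
  - by rewrite scaler0.
exists b, (Some (b^-1 *: X)); congr (_, _, _) => /=.
- rewrite !dot_bilinear.
  have -> : dot X X = a * b by lra.
  by field.
- by rewrite mulr1.
- by rewrite scalerA divff // scale1r.
Qed.

Lemma null_vector_inj t t' q q' :
  t != 0 ->
  scale_vector t (null_vector q) = scale_vector t' (null_vector q') -> q = q'.
Proof.
rewrite /scale_vector.
case: q q' => [p|] [p'|] //= t0 [].
- rewrite !mulr1 => _ <- /(congr1 (fun x : 'rV_n => t^-1 *: x)).
  by rewrite !scalerA mulVf // !scale1r => ->.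
- by rewrite !mulr1 mulr0 => _ tE; rewrite tE eqxx in t0.
- rewrite !mulr1 !mulr0 => tE t'E _.
  by rewrite -t'E mul0r in tE; rewrite tE eqxx in t0.
Qed.

(** For finite [p] the two hypotheses combine to [|X - b p|^2 = 0], and [dot] is definite. *)
Lemma null_vector_orth u q :
  lorentz u u = 0 -> lorentz u (null_vector q) = 0 ->
  exists t, u = scale_vector t (null_vector q).
Proof.
case: u => [[a b] X]; rewrite /lorentz.
case: q => [p|] /= u0 uq; last first.
  have b0 : b = 0 by move: uq; rewrite dot_bilinear; lra.
  have X0 : X = 0 by apply: dot_eq0; move: u0; rewrite b0; lra.
  exists a; rewrite b0 X0; congr (_, _, _) => /=.
  - by rewrite mulr1.
  - by rewrite mulr0.
  - by rewrite scaler0.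
have XE : X = b *: p.
  apply/eqP; rewrite -subr_eq0; apply/eqP/dot_eq0.
  by rewrite !dot_bilinear (dotC p X); nra.
exists b; congr (_, _, _) => /=.
- by move: uq; rewrite XE !dot_bilinear; lra.
- by rewrite mulr1.
- exact: XE.
Qed.

(* With curvature [b] and centre [x] these are the augmented curvature-center
   coordinates: the first entry [b * (|x|^2 - r^2)] is the curvature of the
   inversion of [S] in the unit sphere. *)
Definition lorentz_vector S : R * R * 'rV[R]_n :=
  match S with
  | OSphere x rho _ inward =>
      let b := (oriented_radius rho inward)^-1 in
      (b * (dot x x - rho ^+ 2), b, b *: x)
  | OHyperplane h c _ => (2 * c, 0, h)
  end.

Lemma curvature_centerE S :
  curvature_center S = row_mx (lorentz_vector S).1.2%:M (lorentz_vector S).2.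
Proof. by case: S => //= h c h1; rewrite raddf0. Qed.

Lemma oriented_radius_neq0 (rho : R) inward :
  0 < rho -> oriented_radius rho inward != 0.
Proof. by move=> rho0; case: inward; rewrite /= ?oppr_eq0 gt_eqF. Qed.

Lemma sqr_oriented_radius (rho : R) inward :
  oriented_radius rho inward ^+ 2 = rho ^+ 2.
Proof. by case: inward; rewrite /= ?sqrrN. Qed.

Lemma lorentz_vector_unit S :
  lorentz (lorentz_vector S) (lorentz_vector S) = 1.
Proof.
case: S => [x rho rho0 inward|h c h1]; rewrite /lorentz /=.
  rewrite !dot_bilinear -(sqr_oriented_radius rho inward).
  by field; rewrite oriented_radius_neq0.
by rewrite -sqr_enorm (eqP h1); ring.
Qed.

Lemma lorentz_vector_reverse S :
  lorentz_vector (reverse S) = - lorentz_vector S.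
Proof.
case: S => [x rho rho0 inward|h c h1] /=; congr (_, _, _) => /=.
- by case: inward; rewrite /= ?invrN ?mulNr ?opprK.
- by case: inward; rewrite /= ?invrN ?opprK.
- by case: inward; rewrite /= ?invrN ?scaleNr ?opprK.
- by rewrite mulrN.
- by rewrite oppr0.
Qed.

(** For a sphere the product is [b / 2] times the negated power of a finite point, and [- b / 2] at
    infinity. *)
Lemma pointsE S q :
  points S q <-> lorentz (lorentz_vector S) (null_vector q) = 0.
Proof.
case: S => [x rho rho0 inward|h c h1]; case: q => [p|];
  rewrite /lorentz /= ?dot_bilinear.
- have b0 := oriented_radius_neq0 rho inward rho0.
  set b := _^-1; have bN0 : b != 0 by rewrite invr_eq0.
  have -> : b * dot x p - (b * (dot x x - rho ^+ 2) * 1 + dot p p * b) / 2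
      = b / 2 * (rho ^+ 2 - enorm (p - x) ^+ 2).
    by rewrite sqr_enorm !dot_bilinear (dotC p x); field.
  split=> [->|]; first by rewrite subrr mulr0.
  move/eqP; rewrite !mulf_eq0 (negPf bN0) invr_eq0 pnatr_eq0 /= subr_eq0.
  rewrite eq_sym eqrXn2 ?enorm_ge0 ?ltW //.
  by move/eqP.
- split=> // /eqP; set b := _^-1.
  have bN0 : b != 0 by rewrite invr_eq0 oriented_radius_neq0.
  have -> : 0 - (b * (dot x x - rho ^+ 2) * 0 + 1 * b) / 2 = - b / 2 by ring.
  by rewrite mulf_eq0 oppr_eq0 (negPf bN0) invr_eq0 pnatr_eq0.
- by split; lra.
- by split=> // _; lra.
Qed.

Lemma interiorE S p :
  interior S p <-> 0 < lorentz (lorentz_vector S) (null_vector (Some p)).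
Proof.
case: S => [x rho rho0 inward|h c h1]; rewrite /lorentz /= ?dot_bilinear;
  last by split; lra.
have b0 := oriented_radius_neq0 rho inward rho0.
set b := _^-1; have bN0 : b != 0 by rewrite invr_eq0.
have -> : b * dot x p - (b * (dot x x - rho ^+ 2) * 1 + dot p p * b) / 2
    = b / 2 * (rho ^+ 2 - enorm (p - x) ^+ 2).
  by rewrite sqr_enorm !dot_bilinear (dotC p x); field.
rewrite /b; case: (inward) => /=.
  rewrite pmulr_rgt0 ?divr_gt0 ?invr_gt0 // subr_gt0.
  by rewrite ltr_pXn2r ?nnegrE ?enorm_ge0 ?ltW.
rewrite nmulr_rgt0; last by rewrite invrN mulNr oppr_lt0 divr_gt0 ?invr_gt0.
by rewrite subr_lt0 ltr_pXn2r ?nnegrE ?enorm_ge0 ?ltW.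
Qed.

Lemma lorentz_vector_surj u :
  lorentz u u = 1 -> exists S, lorentz_vector S = u.
Proof.
case: u => [[a b] X]; rewrite /lorentz /= => u1.
have [b0|bN0] := eqVneq b 0.
  have X1 : enorm X == 1 by rewrite /enorm (_ : dot X X = 1) ?sqrtr1 //; nra.
  by exists (OHyperplane (a / 2) X1); rewrite b0 /=; congr (_, _, _); field.
have rho0 : 0 < `|b|^-1 by rewrite invr_gt0 normr_gt0.
have bE : (oriented_radius `|b|^-1 (0 < b))^-1 = b.
  rewrite /oriented_radius; case: ltrP => b_sgn.
    by rewrite invrK gtr0_norm.
  by rewrite invrN invrK ler0_norm // opprK.
exists (OSphere (b^-1 *: X) rho0 (0 < b)) => /=; rewrite bE.
congr (_, _, _); last by rewrite scalerA divff // scale1r.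
rewrite !dot_bilinear exprVn real_normK ?num_real //.
have -> : dot X X = 1 + a * b by lra.
by field.
Qed.

Lemma lorentz_vector_inj : injective lorentz_vector.
Proof.
move=> S T.
have cN0 (rho : R) s : 0 < rho -> (oriented_radius rho s)^-1 != 0.
  by move=> r0; rewrite invr_eq0 oriented_radius_neq0.
case: S T => [x rho rho0 s|h c h1] [x' rho' rho'0 s'|h' c' h'1] //=.
- case=> _ bE; rewrite bE.
  move/(congr1 (fun y : 'rV_n => oriented_radius rho' s' *: y)).
  rewrite !scalerA mulfV ?oriented_radius_neq0 // !scale1r => <-.
  have {bE} /invr_inj rE := bE.
  have [sE rhoE] : s = s' /\ rho = rho'.
    by case: s s' rE => [] [] /= rE; split=> //; lra.
  by subst s' rho'; congr OSphere; exact: bool_irrelevance.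
- by case=> _ b0; have := cN0 rho s rho0; rewrite b0 eqxx.
- by case=> _ b0; have := cN0 rho' s' rho'0; rewrite -b0 eqxx.
- case=> cE hE; subst h'; have {cE} cE : c = c' by lra.
  by subst c'; congr OHyperplane; exact: bool_irrelevance.
Qed.

End LorentzModel.

(** * From a Descartes configuration to its Gram matrix *)

Section TangentSpheres.
Context {R : realType} {n : nat}.
Implicit Types (u v : R * R * 'rV[R]_n) (p d : 'rV[R]_n).

Lemma lorentz_shift u p d :
  lorentz u (null_vector (Some (p + d))) =
  lorentz u (null_vector (Some p)) + dot (u.2 - u.1.2 *: p) d
    - u.1.2 * dot d d / 2.
Proof. by rewrite /lorentz /= !dot_bilinear (dotC d p); field. Qed.

Lemma dot_normal u v p :
  dot (u.2 - u.1.2 *: p) (v.2 - v.1.2 *: p) =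
  lorentz u v - u.1.2 * lorentz v (null_vector (Some p))
    - v.1.2 * lorentz u (null_vector (Some p)).
Proof. by rewrite /lorentz /= !dot_bilinear (dotC p v.2); field. Qed.

(* At a finite common point the unit normals have inner product
   [lorentz u v]; unless they are opposite, a short step along their sum
   enters both interiors.  At infinity the same holds for a long step. *)
Lemma disjoint_lorentz u v q :
  lorentz u u = 1 -> lorentz v v = 1 ->
  lorentz u (null_vector q) = 0 -> lorentz v (null_vector q) = 0 ->
  (forall p, 0 < lorentz u (null_vector (Some p)) ->
     0 < lorentz v (null_vector (Some p)) -> False) ->
  lorentz u v = -1.
Proof.
move=> u1 v1 uq vq disj.
have key (N N' : 'rV[R]_n) : dot N N = 1 -> dot N' N' = 1 ->
    lorentz u v = dot N N' -> lorentz u v = -1 \/ 0 < 1 + dot N N'.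
  move=> N1 N'1 ->; have := dot_ge0 (N + N').
  rewrite !dot_bilinear N1 N'1 (dotC N' N) => g.
  by have [->|gN1] := eqVneq (dot N N') (-1); [left | right; lra].
case: q uq vq => [p|] uq vq.
  have [N NE] : exists N, N = u.2 - u.1.2 *: p by eexists.
  have [N' N'E] : exists N', N' = v.2 - v.1.2 *: p by eexists.
  have N1 : dot N N = 1 by rewrite NE dot_normal u1 uq; ring.
  have N'1 : dot N' N' = 1 by rewrite N'E dot_normal v1 vq; ring.
  have g : lorentz u v = dot N N' by rewrite NE N'E dot_normal uq vq; ring.
  have [//|g1] := key _ _ N1 N'1 g.
  (* After a step [e *: (N + N')] the product is [e (1 + dot N N') (1 - b e)]; this [e] keeps
     [b e < 1] for both curvatures [b]. *)
  pose e := (1 + `|u.1.2| + `|v.1.2|)^-1.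
  have e_den : 0 < 1 + `|u.1.2| + `|v.1.2|.
    by rewrite -addrA ltr_pwDl // addr_ge0.
  have e_gt0 : 0 < e by rewrite invr_gt0.
  have step (b : R) : b < 1 + `|u.1.2| + `|v.1.2| ->
      0 < e * (1 + dot N N') * (1 - b * e).
    by move=> b_lt; rewrite !mulr_gt0 ?subr_gt0 // ltr_pdivrMr // mul1r.
  have := ler_norm u.1.2; have := ler_norm v.1.2.
  have := normr_ge0 u.1.2; have := normr_ge0 v.1.2 => nv nu lv lu.
  exfalso; apply: (disj (p + e *: (N + N'))); rewrite lorentz_shift ?uq ?vq.
    rewrite -NE !dot_bilinear N1 N'1 (dotC N' N).
    by have := step u.1.2; set b := u.1.2; set c := dot N N'; lra.
  rewrite -N'E !dot_bilinear N1 N'1 (dotC N' N).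
  by have := step v.1.2; set b := v.1.2; set c := dot N N'; lra.
have ub : u.1.2 = 0 by move: uq; rewrite /lorentz /= dot_bilinear; lra.
have vb : v.1.2 = 0 by move: vq; rewrite /lorentz /= dot_bilinear; lra.
have uX : dot u.2 u.2 = 1 by move: u1; rewrite /lorentz ub; lra.
have vX : dot v.2 v.2 = 1 by move: v1; rewrite /lorentz vb; lra.
have g : lorentz u v = dot u.2 v.2 by rewrite /lorentz ub vb; lra.
have [//|g1] := key _ _ uX vX g.
(* At [t *: (u.2 + v.2)] the products are [t (1 + dot u.2 v.2)] minus half of [u.1.1] or [v.1.1];
   this [t] makes both positive. *)
pose t := (1 + `|u.1.1| + `|v.1.1|) / (1 + dot u.2 v.2).
have tE : t * (1 + dot u.2 v.2) = 1 + `|u.1.1| + `|v.1.1|.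
  by rewrite divfK ?gt_eqF.
have := ler_norm u.1.1; have := ler_norm v.1.1.
have := normr_ge0 u.1.1; have := normr_ge0 v.1.1.
move=> nv nu lv lu.
exfalso; apply: (disj (t *: (u.2 + v.2)));
  rewrite /lorentz /= !dot_bilinear ?ub ?vb uX vX ?(dotC v.2); lra.
Qed.

Lemma Descartes_gram (S : {ffun 'I_n.+2 -> osphere R n}) :
  oriented_Descartes S ->
  forall i j, lorentz (lorentz_vector (S i)) (lorentz_vector (S j)) =
    if i == j then 1 else -1.
Proof.
case=> tang _ disj i j; have [<-|ij] := eqVneq.
  by rewrite lorentz_vector_unit.
have [q] := tang i j ij; rewrite /tangent_at => tq.
have [/pointsE iq /pointsE jq] : (points (S i) `&` points (S j))%classic q.
  by rewrite tq.
case: disj => disj.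
  apply: (@disjoint_lorentz _ _ q) => //; try exact: lorentz_vector_unit.
  move=> p /interiorE ip /interiorE jp.
  by case/eqP: ij; apply: disj => //; exists p.
(* Reversal negates both vectors and so preserves their product. *)
have := @disjoint_lorentz (- lorentz_vector (S i)) (- lorentz_vector (S j)) q.
rewrite !(lorentzNl, lorentzNr) !opprK !lorentz_vector_unit iq jq oppr0.
apply=> // p.
rewrite -!lorentz_vector_reverse => /interiorE ip /interiorE jp.
by case/eqP: ij; apply: disj => //; exists p.
Qed.

End TangentSpheres.

(** * From the Gram matrix back to a Descartes configuration *)

Section Descartes.
Context {R : realType} {n : nat}.
Context (n_gt0 : (0 < n)%N) (S : {ffun 'I_n.+2 -> osphere R n}).
Local Notation w i := (lorentz_vector (S i)).
Context (gram :
  forall i j, lorentz (w i) (w j) = if i == j then 1 else -1).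

(** A third vector has product -2 with [w i + w j], which shows that this sum is nonzero. *)
Lemma third_index (i j : 'I_n.+2) : exists k, (i != k) && (j != k).
Proof.
apply/existsP; apply: contraT; rewrite negb_exists => /forallP all_ij.
have : (#|'I_n.+2| <= #|[set i; j]|)%N.
  apply/subset_leq_card/fintype.subsetP => k _; rewrite !inE.
  by have := all_ij k; rewrite negb_and !negbK !(eq_sym k).
by rewrite card_ord cards2; case: (i == j) => /=; case: (n) n_gt0.
Qed.

Lemma pair_null i j : i != j ->
  exists t q, t != 0 /\ w i + w j = scale_vector t (null_vector q).
Proof.
move=> ij.
have /null_vector_param[t [q wE]] : lorentz (w i + w j) (w i + w j) = 0.
  rewrite !(lorentzDl, lorentzDr) !gram !eqxx (negPf ij) eq_sym (negPf ij).
  ring.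
exists t, q; split=> //; have [k /andP[ik jk]] := third_index i j.
have := congr1 (lorentz^~ (w k)) wE => /=.
rewrite lorentzDl lorentzZl !gram (negPf ik) (negPf jk) => tk.
by apply/eqP => t0; move: tk; rewrite t0; lra.
Qed.

(** A common point is a null direction orthogonal to the null vector [w i + w j], hence parallel to
    it. *)
Lemma pair_tangent i j t q : i != j -> t != 0 ->
  w i + w j = scale_vector t (null_vector q) -> tangent_at (S i) (S j) q.
Proof.
move=> ij t0 wE; apply/seteqP; split=> q' /=.
  case=> /pointsE iq' /pointsE jq'.
  have [||t' wE'] := @null_vector_orth _ _ (w i + w j) q'.
  - rewrite !(lorentzDl, lorentzDr) !gram !eqxx (negPf ij) eq_sym (negPf ij).
    ring.
  - by rewrite lorentzDl iq' jq' addr0.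
  by rewrite wE in wE'; rewrite (null_vector_inj _ _ _ _ t0 wE').
move=> ->; split; apply/pointsE/(mulfI t0); rewrite mulr0 -lorentzZr -wE;
  rewrite lorentzDr !gram !eqxx ?(negPf ij) 1?eq_sym ?(negPf ij); ring.
Qed.

(** Such a [q] would be the direction of [w i + w j], whose product with [w k] is -2 instead of
    0. *)
Lemma no_common_point i j k q :
  i != j -> i != k -> j != k ->
  points (S i) q -> points (S j) q -> points (S k) q -> False.
Proof.
move=> ij ik jk iq jq /pointsE kq.
have [t [q' [t0 wE]]] := pair_null _ _ ij.
have qq' : q = q'.
  have /seteqP[+ _] := pair_tangent _ _ _ _ ij t0 wE; apply; split=> //.
have := congr1 (lorentz (w k)) wE.
rewrite lorentzDr lorentzZr -qq' kq !gram !(eq_sym k) (negPf ik) (negPf jk).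
lra.
Qed.

(* Distinct pairs have [lorentz (w i + w j) (w k + w l) < 0], whereas two
   vectors of the closed future null cone never have a positive product: so
   all the [w i + w j] lie in the same half of the cone. *)
Lemma pair_sign i j k l t t' q q' :
  i != j -> k != l -> t != 0 -> t' != 0 ->
  w i + w j = scale_vector t (null_vector q) ->
  w k + w l = scale_vector t' (null_vector q') -> 0 < t * t'.
Proof.
move=> ij kl t0 t'0 wE wE'.
have [same|diff] := boolP [|| (i == k) && (j == l) | (i == l) && (j == k)].
  have {}wE' : w i + w j = scale_vector t' (null_vector q').
    rewrite -wE'; case/orP: same => /andP[/eqP -> /eqP ->] //.
    by rewrite addrC.
  have qq' : q = q' by apply: (null_vector_inj t t'); rewrite -?wE.
  (* With [z] the product of [w m] and the null vector, [t z = t' z = -2], so [t t' z^2 = 4]. *)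
  have [m /andP[im jm]] := third_index i j.
  have := congr1 (lorentz (w m)) wE; have := congr1 (lorentz (w m)) wE'.
  rewrite lorentzDr !lorentzZr -qq' !gram !(eq_sym m) (negPf im) (negPf jm).
  by move=> /= c c'; have := sqr_ge0 (lorentz (w m) (null_vector q)); nra.
have : lorentz (w i + w j) (w k + w l) < 0.
  rewrite !(lorentzDl, lorentzDr) !gram.
  (* Distinct pairs share at most one index, so at most one of the four products is 1 and the sum is
     at most -2. *)
  have both (x y z : 'I_n.+2) : x != y -> ~~ ((x == z) && (y == z)).
    by apply: contra => /andP[/eqP -> /eqP ->].
  move: (both _ _ k ij) (both _ _ l ij) (both _ _ i kl) (both _ _ j kl) diff.
  rewrite !(eq_sym k) !(eq_sym l).
  case: (i == k) (i == l) (j == k) (j == l) => [] [] [] [] //=; lra.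
rewrite wE wE' lorentzZl lorentzZr.
have := null_vector_le0 q q'; nra.
Qed.

Lemma gram_Descartes : oriented_Descartes S.
Proof.
split.
- move=> i j ij; have [t [q [t0 wE]]] := pair_null _ _ ij.
  by exists q; exact: pair_tangent wE.
- move=> i j k l q ij kl tij tkl.
  have [iq jq] : (points (S i) `&` points (S j))%classic q by rewrite tij.
  have [kq lq] : (points (S k) `&` points (S l))%classic q by rewrite tkl.
  have [ik|ik] := eqVneq i k.
    left; split=> //; apply/eqP; apply: contraT => jl; subst k.
    by case: (no_common_point _ _ _ _ ij kl jl iq jq lq).
  have [jk|jk] := eqVneq j k; last first.
    by case: (no_common_point _ _ _ _ ij ik jk iq jq kq).
  right; split=> //; apply/eqP; apply: contraT => il; subst k.
  by case: (no_common_point _ _ _ _ ij il kl iq jq lq).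
have ij0 : (ord0 : 'I_n.+2) != ord_max by [].
have [t0 [q0 [t0N0 wE0]]] := pair_null _ _ ij0.
(* The two products at [p] cannot both have the sign of [t0], so that sign decides which orientation
   has disjoint interiors. *)
have sgn i j p : i != j ->
    t0 * (lorentz (w i) (null_vector (Some p)) +
          lorentz (w j) (null_vector (Some p))) <= 0.
  move=> ij; have [t [q [tN0 wE]]] := pair_null _ _ ij.
  rewrite -lorentzDl wE lorentzZl mulrA pmulr_rle0 ?null_vector_le0 //.
  exact: pair_sign wE0 wE.
have [t0_gt0|t0_lt0|t0E] := ltrgtP 0 t0; last by rewrite t0E eqxx in t0N0.
  left=> i j _ _ [p [/interiorE ip /interiorE jp]].
  by apply/eqP; apply: contraT => ij; have := sgn i j p ij; nra.
right=> i j _ _ [p [/interiorE + /interiorE]].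
rewrite !lorentz_vector_reverse !lorentzNl => ip jp.
by apply/eqP; apply: contraT => ij; have := sgn i j p ij; nra.
Qed.

End Descartes.

(** * Matrix form of the Gram condition *)

Section GramMatrix.
Context {R : realType} {n : nat}.
Local Notation Q := (Qform R n).
Implicit Types (a b : 'cV[R]_n.+2) (X : 'M[R]_(n.+2, n)).

Definition gram_mx a b X : 'M[R]_n.+2 :=
  X *m X^T - 2^-1 *: (a *m b^T + b *m a^T).

Lemma gram_mxE a b X i j :
  gram_mx a b X i j =
  lorentz (a i 0, b i 0, row i X) (a j 0, b j 0, row j X).
Proof.
rewrite /lorentz /= !mxE !big_ord1 !mxE; congr (_ - _); last by field.
by apply: eq_bigr => k _; rewrite !mxE.
Qed.

Definition Descartes_gram_mx : 'M[R]_n.+2 := 2%:M - const_mx 1.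

Lemma Descartes_gram_mxE i j :
  Descartes_gram_mx i j = if i == j then 1 else -1.
Proof. by rewrite !mxE; case: (i == j) => /=; ring. Qed.

Lemma QformE : Q = 1%:M - n%:R^-1 *: const_mx 1.
Proof.
rewrite /Qform (_ : _ *m _ = const_mx 1) //; apply/matrixP => i j.
by rewrite !mxE big_ord1 !mxE mulr1.
Qed.

Lemma tr_Qform : Q^T = Q.
Proof. by rewrite QformE linearB linearZ /= trmx_const tr_scalar_mx. Qed.

(** As [J^2 = (n + 2) J], the coefficient of [J] is [- 1 - 2 / n + (n + 2) / n = 0]. *)
Lemma Qform_gram : (0 < n)%N -> Q *m Descartes_gram_mx = 2%:M.
Proof.
move=> n_gt0; have nN0 : n%:R != 0 :> R by rewrite pnatr_eq0 -lt0n.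
have JJ : (const_mx 1 : 'M[R]_n.+2) *m (const_mx 1 : 'M[R]_n.+2) =
    n.+2%:R *: const_mx 1.
  apply/matrixP => i j; rewrite !mxE.
  under eq_bigr do rewrite !mxE mulr1.
  by rewrite sumr_const card_ord mulr1.
rewrite QformE mulmxBl !mulmxBr !mul1mx -!scalemxAl JJ mul_mx_scalar.
apply/matrixP => i j; rewrite !mxE.
have -> : n.+2%:R = n%:R + 2 :> R by rewrite -natrD addn2.
by field.
Qed.

(** With [W = [a | b | X]] and [V = W G], the Gram matrix is [V W^T]; square factors of [2 I]
    commute, which moves [V] to the right. *)
Lemma gram_mx_dual a b X : (0 < n)%N ->
  gram_mx a b X = Descartes_gram_mx <->
  (row_mx a (row_mx b X))^T *m Q *m
    row_mx (- 2^-1 *: b) (row_mx (- 2^-1 *: a) X) = 2%:M.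
Proof.
move=> n_gt0.
pose W : 'M[R]_n.+2 := row_mx a (row_mx b X).
pose V : 'M[R]_n.+2 := row_mx (- 2^-1 *: b) (row_mx (- 2^-1 *: a) X).
have VW : V *m W^T = gram_mx a b X.
  change (row_mx (- 2^-1 *: b) (row_mx (- 2^-1 *: a) X) *m
    (row_mx a (row_mx b X))^T = gram_mx a b X).
  rewrite !tr_row_mx !mul_row_col /gram_mx -!scalemxAl !scaleNr scalerDr.
  by rewrite addrA addrC opprD [in RHS](addrC (- _)).
have twoN0 : 2 != 0 :> R by rewrite pnatr_eq0.
have QK (A B : 'M[R]_n.+2) : A *m B = 2%:M -> B *m A = 2%:M.
  move=> AB; have /mulmx1C : (2^-1 *: A) *m B = 1%:M.
    by rewrite -scalemxAl AB scale_scalar_mx mulVf.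
  by rewrite -scalemxAr => /(congr1 ( *:%R 2)); rewrite scalerA mulfV // scale1r
    scale_scalar_mx mulr1.
have GQ := QK _ _ (Qform_gram n_gt0).
change (gram_mx a b X = Descartes_gram_mx <-> W^T *m Q *m V = 2%:M).
rewrite -VW; split=> [VWE|/QK].
  by apply: QK; rewrite mulmxA VWE.
rewrite mulmxA => VWQ.
have := congr1 (mulmx^~ Descartes_gram_mx) VWQ.
rewrite -mulmxA Qform_gram // mul_mx_scalar mul_scalar_mx.
by move/(congr1 ( *:%R 2^-1)); rewrite !scalerA mulVf // !scale1r.
Qed.


Lemma tr_Qform_mul m k (A : 'M[R]_(n.+2, m)) (B : 'M[R]_(n.+2, k)) :
  (A^T *m Q *m B)^T = B^T *m Q *m A.
Proof. by rewrite !trmx_mul tr_Qform trmxK mulmxA. Qed.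

Lemma Qform_dual_blocks a b X :
  (row_mx a (row_mx b X))^T *m Q *m
    row_mx (- 2^-1 *: b) (row_mx (- 2^-1 *: a) X) = 2%:M <->
  [/\ (row_mx b X)^T *m Q *m row_mx b X = block_mx 0 0 0 2%:M,
      a^T *m Q *m a = 0, a^T *m Q *m b = (-4)%:M & a^T *m Q *m X = 0].
Proof.
have halfK k l (A B : 'M[R]_(k, l)) : - 2^-1 *: A = B <-> A = (-2) *: B.
  by split=> [<-|->]; rewrite scalerA (_ : _ * _ = 1) ?scale1r //; field.
have scalar1 : 2%:M = col_mx (row_mx 2%:M (row_mx 0 0))
    (col_mx (row_mx 0 (row_mx 2%:M 0)) (row_mx 0 (row_mx 0 2%:M)))
    :> 'M[R]_(1 + (1 + n)).
  rewrite scalar_mx_block (scalar_mx_block 1 n) !block_mxEv row_mx0.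
  by congr col_mx; rewrite -[in LHS]col_mx0 -block_mxEh block_mxEv.
rewrite {}scalar1 !tr_row_mx !mul_col_mx !mul_mx_row -!scalemxAr block_mxEv.
have ba := tr_Qform_mul _ _ a b; have Xb := tr_Qform_mul _ _ b X.
have Xa := tr_Qform_mul _ _ a X.
split.
  case/eq_col_mx => /eq_row_mx[/halfK ab /eq_row_mx[/halfK aa aX]].
  case/eq_col_mx => /eq_row_mx[/halfK bb /eq_row_mx[_ bX]].
  case/eq_row_mx => /halfK Xb0 /eq_row_mx[_ XX].
  rewrite ab aa aX bb bX Xb0 XX !scaler0 scale_scalar_mx; split=> //.
  by congr (_ %:M); ring.
case=> /eq_col_mx[/eq_row_mx[bb bX] /eq_row_mx[Xb0 XX]] aa ab aX.
rewrite -ba -Xa ab aa aX bb bX Xb0 XX !trmx0 !scaler0 tr_scalar_mx.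
by rewrite scale_scalar_mx (_ : _ * _ = 2) //; field.
Qed.

(* [e = (2 - J) b] satisfies [Q e = 2 b]; projecting [e] off the columns of
   [X] and rescaling solves the linear conditions on [a], and adding a
   multiple of [b] makes [a] isotropic. *)
Lemma augment_solution b X : (0 < n)%N -> b != 0 ->
  (row_mx b X)^T *m Q *m row_mx b X = block_mx 0 0 0 2%:M ->
  exists a, gram_mx a b X = Descartes_gram_mx.
Proof.
move=> n_gt0 bN0 MQM; have := MQM.
rewrite !tr_row_mx !mul_col_mx !mul_mx_row block_mxEv.
case/eq_col_mx => /eq_row_mx[bb bX] /eq_row_mx[Xb XX].
pose s := (b^T *m b) 0 0.
have sE : b^T *m b = s%:M := mx11_scalar _.
have sN0 : s != 0.
  apply: contraNneq bN0; rewrite /s mxE => /eqP.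
  rewrite psumr_eq0 => [/allP b0|i _]; last by rewrite mxE -expr2 sqr_ge0.
  apply/eqP/colP => i; rewrite [RHS]mxE.
  by have := b0 i (mem_index_enum i); rewrite mxE mulf_eq0 orbb => /eqP.
(* The vector in parentheses pairs with [b] to [2 s] under [Q], so the factor [- 2 / s] yields
   -4. *)
pose a0 := (- 2 / s) *: (Descartes_gram_mx *m b - X *m (X^T *m b)).
have a0b : b^T *m Q *m a0 = (-4)%:M.
  rewrite -scalemxAr mulmxBr !mulmxA bX !mul0mx subr0.
  rewrite -(mulmxA b^T) Qform_gram // mul_mx_scalar -scalemxAl sE.
  by rewrite !scale_scalar_mx; congr _%:M; field.
have a0X : X^T *m Q *m a0 = 0.
  rewrite -scalemxAr mulmxBr !mulmxA XX.
  rewrite -(mulmxA X^T Q) Qform_gram // mul_mx_scalar mul_scalar_mx.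
  by rewrite -scalemxAl subrr scaler0.
move: a0 a0b a0X => a0 a0b a0X.
pose c := (a0^T *m Q *m a0) 0 0.
have cE : a0^T *m Q *m a0 = c%:M := mx11_scalar _.
have ba0 : a0^T *m Q *m b = (-4)%:M.
  by rewrite -tr_Qform_mul a0b tr_scalar_mx.
(* As [b] is isotropic for [Q], adding [t *: b] turns [c] into [c - 8 t]; hence [t = c / 8]. *)
have shiftl q k (A : 'M_(_, k)) : (a0 + (c / 8) *: b)^T *m q *m A =
    a0^T *m q *m A + (c / 8) *: (b^T *m q *m A).
  by rewrite linearD linearZ /= !mulmxDl -!scalemxAl.
have shiftr q k (A : 'M_(k, _)) : A *m q *m (a0 + (c / 8) *: b) =
    A *m q *m a0 + (c / 8) *: (A *m q *m b).
  by rewrite mulmxDr -scalemxAr.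
exists (a0 + (c / 8) *: b); apply/gram_mx_dual => //.
apply/Qform_dual_blocks; split=> //; rewrite shiftl ?shiftr.
- rewrite cE ba0 a0b bb scaler0 addr0 !scale_scalar_mx -!raddfD /=.
  by rewrite (_ : _ + _ = 0) ?raddf0 //; field.
- by rewrite ba0 bb scaler0 addr0.
- by rewrite bX scaler0 addr0 -tr_Qform_mul a0X trmx0.
Qed.

End GramMatrix.

(** * Matrices of configurations and the final equivalence *)

Lemma curvature_center_coord {R : realType} {n : nat}
    (S : {ffun 'I_n.+2 -> osphere R n}) (i : 'I_n.+2) :
  lorentz_vector (S i) =
  ((lorentz_vector (S i)).1.1, lsubmx (curvature_center_mx S) i 0,
   row i (rsubmx (curvature_center_mx S))).
Proof.
have := rowK (fun j => curvature_center (S j)) i.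
rewrite -/(curvature_center_mx S) curvature_centerE.
rewrite -[X in row i X = _](hsubmxK (curvature_center_mx S)) row_row_mx.
case/eq_row_mx => /(congr1 (fun A : 'M_1 => A 0 0)).
rewrite [RHS]mxE mxE eqxx mulr1n => -> ->.
by case: (lorentz_vector _) => [[]].
Qed.

Lemma gram_mx_lorentz {R : realType} {n : nat}
    (S : {ffun 'I_n.+2 -> osphere R n}) :
  gram_mx (\col_i (lorentz_vector (S i)).1.1)
    (lsubmx (curvature_center_mx S)) (rsubmx (curvature_center_mx S)) =
  \matrix_(i, j) lorentz (lorentz_vector (S i)) (lorentz_vector (S j)).
Proof.
apply/matrixP => i j; rewrite gram_mxE [in LHS]mxE.
by rewrite [X in lorentz _ (X, _, _)]mxE -!curvature_center_coord [RHS]mxE.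
Qed.

(* [M = row_mx b X] with curvature column [b = lsubmx M].  The hypothesis
   [lsubmx M != 0] is needed: if the columns of X are pairwise orthogonal of
   square norm 2 and orthogonal to the all-ones vector, then [row_mx 0 X]
   solves the equation, but it belongs to no Descartes configuration since at
   most two of the spheres are hyperplanes. *)
Theorem theorem3p2 (R : realType) (n : nat) (hn : (2 <= n)%N) :
  (forall S : {ffun 'I_n.+2 -> osphere R n},
     oriented_Descartes S ->
     (curvature_center_mx S)^T *m Qform R n *m curvature_center_mx S
       = block_mx 0 0 0 2%:M)
  /\
  (forall M : 'M[R]_(n.+2, 1 + n),
     M^T *m Qform R n *m M = block_mx 0 0 0 2%:M ->
     lsubmx M != 0 ->
     exists! S : {ffun 'I_n.+2 -> osphere R n},
       oriented_Descartes S /\ curvature_center_mx S = M).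
Proof.
have n_gt0 : (0 < n)%N by apply: leq_trans hn.
split=> [S /Descartes_gram gram|M MQM bN0].
  rewrite -[curvature_center_mx S]hsubmxK.
  have : gram_mx (\col_i (lorentz_vector (S i)).1.1)
      (lsubmx (curvature_center_mx S)) (rsubmx (curvature_center_mx S)) =
      Descartes_gram_mx.
    rewrite gram_mx_lorentz.
    by apply/matrixP => i j; rewrite mxE gram Descartes_gram_mxE.
  by move/(gram_mx_dual _ _ _ n_gt0)/Qform_dual_blocks => [].
rewrite -[M]hsubmxK in MQM.
have [a gramE] := augment_solution _ _ n_gt0 bN0 MQM.
pose w i : R * R * 'rV[R]_n := (a i 0, lsubmx M i 0, row i (rsubmx M)).
have wE i j : lorentz (w i) (w j) = if i == j then 1 else -1.
  by rewrite -gram_mxE gramE Descartes_gram_mxE.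
have /choice[f fE] i : exists S, lorentz_vector S = w i.
  by apply: lorentz_vector_surj; rewrite wE eqxx.
have SE : curvature_center_mx (finfun f) = M.
  rewrite -[LHS]hsubmxK -[RHS]hsubmxK; congr row_mx.
    apply/colP => i; have := curvature_center_coord (finfun f) i.
    by rewrite ffunE fE => -[].
  apply/row_matrixP => i; have := curvature_center_coord (finfun f) i.
  by rewrite ffunE fE => -[].
exists (finfun f); split.
  split=> //; apply: gram_Descartes => // i j.
  by rewrite !ffunE !fE wE.
move=> S' [/Descartes_gram gram' S'E].
apply/ffunP => i; apply: lorentz_vector_inj; rewrite ffunE fE.
have [k bk] : exists k, lsubmx M k 0 != 0.
  apply/existsP; apply: contraNT bN0; rewrite negb_exists => /forallP b0.
  apply/eqP/colP => k; rewrite [RHS]mxE; apply/eqP.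
  by have := b0 k; rewrite negbK.
have [a' coord] : exists a', forall j,
    lorentz_vector (S' j) = (a' j, lsubmx M j 0, row j (rsubmx M)).
  exists (fun j => (lorentz_vector (S' j)).1.1) => j.
  by rewrite {1}curvature_center_coord S'E.
have := gram' i i; have := gram' i k.
rewrite -!wE !coord /lorentz /= => ik ii; congr (_, _, _).
(* The first coordinate is forced by the product with sphere [k] of nonzero curvature if [b_i = 0],
   and by the unit norm otherwise. *)
have [bi0|biN0] := eqVneq (lsubmx M i 0) 0.
  by apply/(mulIf bk); move: ik; rewrite bi0; lra.
by apply/(mulIf biN0); move: ii; lra.
Qed.
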